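(* For every non-negative integer $n$, there exist a finite (possibly empty) word $u_n$ and nonempty finite words $w_1,w_2,\dots$ such that $$S=u_nw_1w_2w_3\cdots$$ and each $w_i$, regarded as a subrow of $S$ (i.e. at the position at which it occurs in this factorization), is $k$-regular for some $k\ge n$ (equivalently, is $n$-regular).
   Context: Words are over the alphabet $\{1,2\}$; $|v|$ is the length of $v$. For a finite or infinite word $v=a_1a_2\cdots$, its integral $v^{-1}$ is obtained by replacing each letter $a_i$ by $a_i$ copies of the letter $1$ if $i$ is odd and by $a_i$ copies of the letter $2$ if $i$ is even. Set $v^0=v$, $v^{-k}=(v^{-(k-1)})^{-1}$. The Kolakoski sequence $S=s_1s_2\cdots=1221121221\cdots$ is the unique infinite word over $\{1,2\}$ with $S^{-1}=S$. For $1\le a\le b$ write $S_{a,b}=s_a\cdots s_b$; a subrow of $S$ is such an occurrence (word together with its starting position). The $S$-integral of the subrow $w=S_{a,b}$ is the subrow $w_S^{-1}:=S_{|u^{-1}|+1,\;|u^{-1}|+|w^{-1}|}$, where $u=s_1\cdots s_{a-1}$ (empty if $a=1$); iterate: $w_S^{0}=w$, $w_S^{-n}=(w_S^{-(n-1)})_S^{-1}$. A subrow $w$ is $k$-regular if $|w_S^{-h}|$ is even for every $0\le h\le k$. *)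

(* Defs.v *)
From HB Require Import structures.
From mathcomp Require Import all_boot.

Set Implicit Arguments.
Unset Strict Implicit.
Unset Printing Implicit Defensive.

Inductive letter := L1 | L2.

Definition nat_of_letter (a : letter) : nat := if a is L1 then 1 else 2.
Coercion nat_of_letter : letter >-> nat.

Definition is_L2 (a : letter) : bool := if a is L2 then true else false.
Definition letter_of_bool (b : bool) : letter := if b then L2 else L1.
Fact is_L2K : cancel is_L2 letter_of_bool. Proof. by case. Qed.
HB.instance Definition _ := Equality.copy letter (can_type is_L2K).

(* Positions in words are numbered from 0: the letter s_i of an infinite word
   S is [S i.-1]. *)
Definition word := seq letter.
Definition iword := nat -> letter.

Definition prepend (u : word) (v : iword) : iword :=
  fun i => if i < size u then nth L1 u i else v (i - size u).

(* w_0 w_1 w_2 ... ; meaningful only if every [w i] is nonempty, in which case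
   the first i+1 words have total length > i and the default is never used. *)
Definition iconcat (w : nat -> word) : iword :=
  fun i => nth L1 (flatten (mkseq w i.+1)) i.

(* The contribution to an integral of the letter [a] in 0-based position [i]:
   the parity is reversed with respect to 1-based numbering. *)
Definition block (i : nat) (a : letter) : word :=
  nseq a (if odd i then L2 else L1).

Definition integral (v : word) : word :=
  flatten (mkseq (fun i => block i (nth L1 v i)) (size v)).

Definition iintegral (v : iword) : iword :=
  iconcat (fun i => block i (v i)).

Definition is_kolakoski (S : iword) : Prop := iintegral S =1 S.

(* An occurrence in an infinite word S: [Subrow p l] stands for
   S_{a,b} with a = p + 1 and b = p + l, so that p = |s_1 ... s_(a-1)|. *)
Record subrow := Subrow { sr_offset : nat; sr_length : nat }.

Definition sr_word (S : iword) (x : subrow) : word :=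
  mkseq (fun j => S (sr_offset x + j)) (sr_length x).

Definition sr_before (S : iword) (x : subrow) : word := mkseq S (sr_offset x).

Definition sr_integral (S : iword) (x : subrow) : subrow :=
  Subrow (size (integral (sr_before S x))) (size (integral (sr_word S x))).

Definition regular (S : iword) (k : nat) (x : subrow) : Prop :=
  forall h, h <= k -> ~~ odd (sr_length (iter h (sr_integral S) x)).

(* The occurrence of [w i] in the factorization u w_0 w_1 w_2 ... *)
Definition factor_subrow (u : word) (w : nat -> word) (i : nat) : subrow :=
  Subrow (size u + size (flatten (mkseq w i))) (size (w i)).

Fact integral_mkseq (v : iword) n :
  integral (mkseq v n) = flatten (mkseq (fun i => block i (v i)) n).
Proof.
rewrite /integral size_mkseq; congr flatten; apply/eq_in_map => i.
by rewrite mem_iota /= => lt_in; rewrite nth_mkseq.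
Qed.

Fact integral_rcons v a :
  integral (rcons v a) = integral v ++ block (size v) a.
Proof.
rewrite /integral size_rcons mkseqS flatten_rcons nth_rcons ltnn eqxx.
congr (flatten _ ++ _); apply/eq_in_map => i.
by rewrite mem_iota /= => lt_i; rewrite nth_rcons lt_i.
Qed.

Fact integral_cat v x : exists y, integral (v ++ x) = integral v ++ y.
Proof.
elim/last_ind: x => [|x a [y IH]]; first by exists [::]; rewrite !cats0.
by rewrite -rcons_cat integral_rcons IH -catA; eexists.
Qed.

Fact size_integral v : size v + (L2 \in v) <= size (integral v).
Proof.
elim/last_ind: v => [//|v a IH].
rewrite integral_rcons size_cat size_nseq size_rcons mem_rcons inE.
move: IH; case: a; case: (L2 \in v) => /=; rewrite ?addn0 ?addn1 ?addn2 ?ltnS //.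
by move/ltnW.
Qed.

Fact iintegralE v i : iintegral v i = nth L1 (integral (mkseq v i.+1)) i.
Proof. by rewrite integral_mkseq. Qed.

Lemma is_kolakoski_exists : exists S, is_kolakoski S.
Proof.
pose t n := iter n integral [:: L1; L2].
have tS n : exists x, t n.+1 = t n ++ x.
  elim: n => [|n [x IH]]; first by exists [:: L2].
  have [y] := integral_cat (t n) x; rewrite -IH => Ey; by exists y.
have tD n m : exists x, t (n + m) = t n ++ x.
  elim: m => [|m [x IH]]; first by exists [::]; rewrite addn0 cats0.
  have [y] := tS (n + m); rewrite addnS IH -catA => ->; by eexists.
have L2t n : L2 \in t n by have [x] := tD 0 n; rewrite add0n => ->.
have size_t n : n < size (t n).
  elim: n => [//|n IH]; apply: leq_trans (size_integral _).
  by rewrite -/(t n) L2t addn1 ltnS.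
have nth_t n i m : i < size (t n) -> n <= m -> nth L1 (t m) i = nth L1 (t n) i.
  by move=> lt_i /subnKC <-; have [x ->] := tD n (m - n); rewrite nth_cat lt_i.
pose S i := nth L1 (t i) i; exists S => i; rewrite iintegralE.
have -> : mkseq S i.+1 = take i.+1 (t i).
  apply: (@eq_from_nth _ L1) => [|j]; rewrite size_mkseq.
    by rewrite size_takel.
  by move=> lt_j; rewrite nth_mkseq // nth_take // (nth_t j).
rewrite [RHS]/S; have <- := nth_t _ _ i.+1 (size_t i) (leqnSn i).
have [y] := integral_cat (take i.+1 (t i)) (drop i.+1 (t i)).
rewrite cat_take_drop -[integral (t i)]/(t i.+1) => ->; rewrite nth_cat.
by rewrite (leq_trans _ (size_integral _)) // size_takel // leq_addr.
Qed.

Lemma is_kolakoski_unique S S' : is_kolakoski S -> is_kolakoski S' -> S =1 S'.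
Proof.
move=> kS kS' i.
have k0 T : is_kolakoski T -> T 0 = L1.
  by move/(_ 0) <-; rewrite iintegralE integral_mkseq /=; case: (T 0).
have k1 T : is_kolakoski T -> T 1 = L2.
  move=> kT; rewrite -(kT 1) iintegralE integral_mkseq /= (k0 _ kT) /=.
  by case: (T 1).
have kE T j : is_kolakoski T -> 1 < j -> T j = nth L1 (integral (mkseq T j)) j.
  move=> kT lt1j; rewrite -{1}(kT j) iintegralE mkseqS integral_rcons nth_cat.
  have L2T : L2 \in mkseq T j by rewrite -(k1 _ kT) map_f // mem_iota.
  have := size_integral (mkseq T j).
  by rewrite L2T size_mkseq addn1 => ->.
elim/ltn_ind: i => -[|[|i]] IH; rewrite ?(k0 S) ?(k0 S') ?(k1 S) ?(k1 S') //.
rewrite (kE S) // (kE S') //; congr (nth _ (integral _) _); apply/eq_in_map => j.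
by rewrite mem_iota => /IH.
Qed.

(* Main.v *)
(* The integral sends the subrow between two cut points p <= q of S to the one
   between F p and F q, where F p = s_1 + ... + s_p. A subrow is therefore
   n-regular as soon as the parities of p, F p, ..., F^n p agree with those of
   q, F q, ..., F^n q. There are only 2^(n+1) possible parity vectors, so one
   of them occurs at infinitely many cut points: cut S at these points. *)

Require Import Defs.
From mathcomp Require Import all_boot.
From Stdlib Require Import Classical.

Lemma infinite_pigeonhole (T : finType) (c : nat -> T) :
  exists v, forall N, exists m, (N <= m) && (c m == v).
Proof.
apply: NNPP => nex.
have bound v : exists N, forall m, N <= m -> c m != v.
  apply: NNPP => nbound; apply: nex; exists v => N.
  apply: NNPP => noccur; apply: nbound; exists N => m le_Nm.
  by apply/negP => cm; apply: noccur; exists m; rewrite le_Nm.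
have [b b_bound] := fin_all_exists bound.
(* The index [\max_v b v] is past the bound of every colour, hence past that of its own colour. *)
by have /eqP[] := b_bound _ _ (leq_bigmax (c (\max_v b v))).
Qed.

Lemma strict_mono_subsequence (P : pred nat) :
    (forall N, exists m, (N <= m) && P m) ->
  exists2 pos : nat -> nat, forall i, pos i < pos i.+1 & forall i, P (pos i).
Proof.
move=> infP.
have [f f_ge f_P] : exists2 f, forall N, N <= f N & forall N, P (f N).
  by exists (fun N => xchoose (infP N)) => N; have /andP[] := xchooseP (infP N).
(* Each step is strict because [f x.+1] is at least [x.+1]. *)
by exists (fun i => iter i (f \o succn) (f 0)) => [i|[|i]] /=.
Qed.

Lemma mkseq_addn (T : Type) (f : nat -> T) m n :
  mkseq f (m + n) = mkseq f m ++ mkseq (fun j => f (m + j)) n.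
Proof.
by rewrite /mkseq iotaD map_cat add0n -{2}[m]addn0 iotaDl -map_comp.
Qed.

Lemma flatten_mkseq_cuts (T : Type) (f : nat -> T) (pos : nat -> nat) k :
    (forall i, pos i <= pos i.+1) ->
  mkseq f (pos 0) ++ flatten
    (mkseq (fun i => mkseq (fun j => f (pos i + j)) (pos i.+1 - pos i)) k)
  = mkseq f (pos k).
Proof.
move=> pos_le; elim: k => [|k IH]; first by rewrite cats0.
by rewrite mkseqS flatten_rcons catA IH -mkseq_addn subnKC.
Qed.

(** Reduces the factorization of [S] to finite prefixes, where the cuts telescope. *)
Lemma prepend_iconcat (u : word) (w : nat -> word) i :
  prepend u (iconcat w) i = nth L1 (u ++ flatten (mkseq w (i - size u).+1)) i.
Proof. by rewrite /prepend nth_cat. Qed.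

(** Unlike the integral itself, its length does not see the parity of positions, so it is additive
    under concatenation. *)
Lemma size_integralE (v : word) :
  size (integral v) = sumn (map nat_of_letter v).
Proof.
elim/last_ind: v => [//|v a IH].
by rewrite integral_rcons size_cat size_nseq map_rcons sumn_rcons IH.
Qed.

(** This is the map F, by [size_integralE]. *)
Definition cut_integral (S : iword) (p : nat) : nat :=
  size (integral (mkseq S p)).

Lemma cut_integralD S p l :
  cut_integral S (p + l)
  = cut_integral S p + size (integral (sr_word S (Subrow p l))).
Proof.
by rewrite /cut_integral mkseq_addn !size_integralE map_cat sumn_cat.
Qed.

(** Tracking the end instead of the length lets the two cut points evolve independently under F. *)
Lemma iter_sr_integral S h p l :
  let x := iter h (sr_integral S) (Subrow p l) in
  sr_offset x = iter h (cut_integral S) p /\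
  sr_offset x + sr_length x = iter h (cut_integral S) (p + l).
Proof.
elim: h => //= h; case: (iter h (sr_integral S) _) => p' l' /= [<- <-].
by rewrite -cut_integralD.
Qed.

(** A finite function, so that the pigeonhole principle applies to parity vectors. *)
Definition cut_parities (S : iword) (n p : nat) : {ffun 'I_n.+1 -> bool} :=
  [ffun h : 'I_n.+1 => odd (iter h (cut_integral S) p)].

Lemma regular_cut_parities S n p l :
  cut_parities S n p = cut_parities S n (p + l) -> regular S n (Subrow p l).
Proof.
move=> eq_par h le_hn.
move/ffunP/(_ (Ordinal (le_hn : h < n.+1))): eq_par; rewrite !ffunE /=.
have [<- <-] := iter_sr_integral S h p l.
by rewrite oddD; case: (odd (sr_offset _)); case: (odd _).
Qed.

Theorem theorem4 (S : iword) (hS : is_kolakoski S) (n : nat) :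
  exists (u : word) (w : nat -> word),
    [/\ forall i, w i != [::],
        S =1 prepend u (iconcat w)
      & forall i, exists2 k, n <= k & regular S k (factor_subrow u w i)].
Proof.
have [v inf_v] := infinite_pigeonhole _ (cut_parities S n).
have [pos pos_lt pos_v] :=
  strict_mono_subsequence (fun m => cut_parities S n m == v) inf_v.
have pos_le i : pos i <= pos i.+1 by exact: ltnW.
have pos_ge i : pos 0 + i <= pos i.
  elim: i => [|i IH]; first by rewrite addn0.
  by rewrite addnS; exact: leq_ltn_trans (pos_lt i).
pose w i := mkseq (fun j => S (pos i + j)) (pos i.+1 - pos i).
have cuts k : mkseq S (pos 0) ++ flatten (mkseq w k) = mkseq S (pos k).
  exact: flatten_mkseq_cuts.
exists (mkseq S (pos 0)), w; split=> i.
- by rewrite -size_eq0 size_mkseq subn_eq0 -ltnNge.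
- rewrite prepend_iconcat cuts size_mkseq nth_mkseq //.
  (* The prefix is long enough: [pos 0 + (i - pos 0)] is the maximum of [pos 0] and [i], even when
     the subtraction truncates. *)
  by apply: leq_trans (pos_ge _); rewrite addnS ltnS -maxnE leq_maxr.
- exists n => //; rewrite /factor_subrow -size_cat cuts !size_mkseq.
  apply: regular_cut_parities; rewrite subnKC //.
  by rewrite (eqP (pos_v i)) (eqP (pos_v i.+1)).
Qed.
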